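(* The Hausdorff dimension of the bifurcation set $\mathcal{E}_{KU}\subset[0,1]$ is zero.
   Context: Farey words. Let $F_0=(0,1)$ be the list of the two one-letter binary words; the list $F_{n+1}$ is obtained from $F_n$ by inserting between every two consecutive words $v,w$ of $F_n$ the concatenation $vw$. Put $FW=\bigcup_{n\ge0}F_n$ and $FW^*=FW\setminus\{0,1\}$. Bifurcation set. For a binary word $w$, $RL(w)$ is the string of positive integers recording the lengths of its successive maximal blocks of equal digits. For $w\in FW^*$ with $S=RL(w)$, let $J_w=(\alpha^-,\alpha^+)$ where $\alpha^+=[0;\overline{S}]$ and $\alpha^-=1-[0;\overline{{}^tS}]$; here ${}^tS$ is the string $S$ reversed and $[0;\overline{S}]$ is the number whose regular continued fraction has partial quotients given by infinite repetition of $S$. Then $\mathcal{E}_{KU}=[0,1]\setminus\bigcup_{w\in FW^*}J_w$. *)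

(* Defs.v *)
From HB Require Import structures.
From mathcomp Require Import all_boot all_order all_algebra.
From mathcomp Require Import all_classical all_reals all_analysis.
Set Implicit Arguments.
Unset Strict Implicit.
Unset Printing Implicit Defensive.
Import Order.TTheory GRing.Theory Num.Theory.
Import numFieldNormedType.Exports.

Local Open Scope classical_set_scope.
Local Open Scope ring_scope.

(* Binary words are of type [seq bool]: the digit 0 is [false], 1 is [true]. *)

Fixpoint insert_concat (s : seq (seq bool)) : seq (seq bool) :=
  match s with
  | v :: ((w :: _) as s') => v :: (v ++ w) :: insert_concat s'
  | _ => s
  end.

Definition farey_list (n : nat) : seq (seq bool) :=
  iter n insert_concat [:: [:: false]; [:: true]].

Definition FW : set (seq bool) := [set w | exists n, w \in farey_list n].

Definition FWstar : set (seq bool) := FW `\` [set [:: false]; [:: true]].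

Fixpoint RL (w : seq bool) : seq nat :=
  match w with
  | [::] => [::]
  | b :: w' =>
      match RL w' with
      | [::] => [:: 1%N]
      | n :: t => if b == head b w' then n.+1 :: t else 1%N :: n :: t
      end
  end.

(* [0; a_1, ..., a_n] = 1 / (a_1 + 1 / (a_2 + ... + 1 / a_n)) *)
Definition cfrac (R : realType) (s : seq nat) : R :=
  foldr (fun (a : nat) (x : R) => (a%:R + x)^-1) 0 s.

(* The value of an infinite continued fraction is the limit of its
   convergents; it is only meant for a nonempty [S] with positive entries. *)
Definition periodic_cfrac (R : realType) (S : seq nat) : R :=
  limn (fun n : nat => cfrac R (mkseq (fun i => nth 0%N S (i %% size S)) n)).

Definition alpha_plus (R : realType) (w : seq bool) : R :=
  periodic_cfrac R (RL w).

Definition alpha_minus (R : realType) (w : seq bool) : R :=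
  1 - periodic_cfrac R (rev (RL w)).

Definition J (R : realType) (w : seq bool) : set R :=
  `]alpha_minus R w, alpha_plus R w[.
Arguments J : clear implicits.

Definition E_KU (R : realType) : set R :=
  `[0, 1] `\` \bigcup_(w in FWstar) J R w.
Arguments E_KU : clear implicits.

(* The maximum with 0 only matters for the empty set, whose supremum of
   distances would otherwise be -oo. *)
Definition diameter (R : realType) (U : set R) : \bar R :=
  maxe 0%E (ereal_sup [set (`|x - y|)%:E | x in U & y in U]).

(* The empty set is treated apart because [poweR 0 0 = 1]: it must not
   contribute to the 0-dimensional measure. *)
Definition diameter_pow (R : realType) (s : R) (U : set R) : \bar R :=
  if U == set0 then 0%E else poweR (diameter U) s.

Definition delta_cover (R : realType) (delta : R) (A : set R)
    (U : nat -> set R) : Prop :=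
  (forall k, (diameter (U k) <= delta%:E)%E) /\ A `<=` \bigcup_k U k.

Definition hausdorff_premeasure (R : realType) (s delta : R) (A : set R)
    : \bar R :=
  ereal_inf [set (\sum_(0 <= k <oo) diameter_pow s (U k))%E
            | U in delta_cover delta A].

Definition hausdorff_measure (R : realType) (s : R) (A : set R) : \bar R :=
  ereal_sup [set hausdorff_premeasure s delta A
            | delta in [set delta : R | 0 < delta]].

Definition hausdorff_dimension (R : realType) (A : set R) : \bar R :=
  ereal_inf [set s%:E | s in [set s : R | 0 <= s /\
                                          hausdorff_measure s A = 0%E]].

(* Main.v *)
Require Import Defs.
From mathcomp Require Import all_boot all_order all_algebra.
From mathcomp Require Import all_classical all_reals all_analysis.
From mathcomp Require Import ring lra zify.

(** Let a binary word act on the half-line [0,oo): the letter 1 as x -> x + 1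
    and the letter 0 as x -> x / (x + 1). Every letter is 1-Lipschitz and the
    factor 01 contracts by 1/4. With w = 0p1, reading off run lengths turns the
    action of w into the continued fraction with partial quotients RL w
    ([cf_fold_RL]), so the right end of J_w is a fixed point of w. Reversing
    RL w amounts to reversing w and exchanging its digits; since x -> 1/x
    conjugates the two letters into each other, for a palindrome p the left end
    of J_w is 0u with u a fixed point of p01 ([alpha_minus_fix]).

    Neighbours v = 0q1 and w = 0p1 in a Farey list satisfy q10p = p01q =: r, a
    palindrome, and vw = 0r1. As r has both q10 and p01 as periods, the right
    end of J_v and the left end of J_w both lie in the image of [0,oo) under 0r
    ([alpha_gap_ends]). That image is small: if v and w are made of a and b
    letters from an alphabet of two words 0...1, its length is at most
    4^(1 - a - b), because each such letter contracts by 1/4.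

    No order relation between the intervals J_w is needed. A point of E_KU,
    not being in J_(vw), lies below its left end or above its right end, so
    the gap of (v, w) meets E_KU inside the gaps of (v, vw) and (vw, w), with
    letter counts (a, a+b) and (a+b, b). The weight 1/(ab) is additive under
    this splitting, 1/(ab) = 1/(a(a+b)) + 1/((a+b)b), while the s-th power of the
    length, 4^(s(1-a-b)), is eventually below e/(ab). Hence splitting deep
    enough covers the gap at cost at most e ([covered_farey_gap]): for every
    s > 0 its intersection with E_KU has measure zero.

    This argument needs two words containing 01, so it does not apply to the
    root pair (0, 1): near 0 and 1 gaps shrink only polynomially. But up to an
    interval of length 1/(k+1) at either end, [0,1] is made of J_01, of
    finitely many J_w and of finitely many gaps of the pairs (00^(k+1)1, 00^k1)
    and (01^k1, 01^(k+1)1), to which the argument does apply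
    ([hausdorff_null_exhaust]). *)

Set Implicit Arguments.
Unset Strict Implicit.
Unset Printing Implicit Defensive.
Import Order.TTheory GRing.Theory Num.Theory.
Import numFieldNormedType.Exports.

Local Open Scope classical_set_scope.
Local Open Scope ring_scope.

(** * Periodic continued fractions *)

Definition cf_step (R : realType) (a : nat) (x : R) : R := (a%:R + x)^-1.

Lemma cf_fold_ge0 (R : realType) (t : seq nat) (x : R) :
  0 <= x -> 0 <= foldr (@cf_step R) x t.
Proof. by move=> x0; elim: t => //= a t IH; rewrite invr_ge0 addr_ge0. Qed.

Lemma cf_step_dist (R : realType) (a : nat) (x y : R) :
  (0 < a)%N -> 0 <= x -> 0 <= y ->
  `|cf_step a x - cf_step a y| <= `|x - y|.
Proof.
move=> a0 x0 y0; rewrite /cf_step.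
have a1 : 1 <= a%:R :> R by rewrite ler1n.
have px : 0 < a%:R + x by lra.
have py : 0 < a%:R + y by lra.
have -> : (a%:R + x)^-1 - (a%:R + y)^-1 =
  (y - x) / ((a%:R + x) * (a%:R + y)) by field; rewrite !gt_eqF.
rewrite normrM distrC [in X in _ * X]ger0_norm ?invr_ge0; last nra.
rewrite ler_pdivrMr ?mulr_gt0// ler_peMr//; nra.
Qed.

Lemma cf_fold_dist (R : realType) (t : seq nat) (x y : R) :
  all (ltn 0) t -> 0 <= x -> 0 <= y ->
  `|foldr (@cf_step R) x t - foldr (@cf_step R) y t| <= `|x - y|.
Proof.
move=> + x0 y0; elim: t => //= a t IH /andP[a0 /IH].
by apply: le_trans; apply: cf_step_dist => //; apply: cf_fold_ge0.
Qed.

Lemma cf_step2_dist (R : realType) (a b : nat) (x y : R) :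
  (0 < a)%N -> (0 < b)%N -> 0 <= x -> 0 <= y ->
  `|cf_step a (cf_step b x) - cf_step a (cf_step b y)| <= 4^-1 * `|x - y|.
Proof.
move=> a0 b0 x0 y0; rewrite /cf_step.
have a1 : 1 <= a%:R :> R by rewrite ler1n.
have b1 : 1 <= b%:R :> R by rewrite ler1n.
have px : 0 < b%:R + x by lra.
have py : 0 < b%:R + y by lra.
have px2 : 2 <= a%:R * (b%:R + x) + 1 by nra.
have py2 : 2 <= a%:R * (b%:R + y) + 1 by nra.
have -> : (a%:R + (b%:R + x)^-1)^-1 - (a%:R + (b%:R + y)^-1)^-1 =
  (x - y) / ((a%:R * (b%:R + x) + 1) * (a%:R * (b%:R + y) + 1)).
  by field; rewrite !gt_eqF//; lra.
rewrite normrM mulrC ler_wpM2r// ger0_norm ?invr_ge0; last nra.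
by rewrite lef_pV2 ?posrE; nra.
Qed.

(** One step of a continued fraction need not contract by a fixed factor, but
    two steps do: the derivative of 1/(a + 1/(b + x)) is 1/(a(b + x) + 1)^2. *)
Lemma cf_fold_contract (R : realType) (k : nat) (t : seq nat) (x y : R) :
  size t = k.*2 -> all (ltn 0) t -> 0 <= x -> 0 <= y ->
  `|foldr (@cf_step R) x t - foldr (@cf_step R) y t| <= 4^-1 ^+ k * `|x - y|.
Proof.
move=> + + x0 y0; elim: k t => [[]//=|k IH [|a [|b t]]//=].
  by rewrite expr0 mul1r.
case=> tk /and3P[a0 b0 t0].
rewrite exprS -mulrA (le_trans (cf_step2_dist _ _ _ _))//.
- exact: cf_fold_ge0.
- exact: cf_fold_ge0.
- by rewrite ler_wpM2l// IH.
Qed.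

Lemma cfrac_itv (R : realType) (s : seq nat) :
  all (ltn 0) s -> 0 <= cfrac R s <= 1.
Proof.
rewrite /cfrac -/(@cf_step R) => s0; rewrite cf_fold_ge0//=.
case: s s0 => [|a s]//= /andP[a0 _].
rewrite invf_le1 ?ltr_wpDr ?cf_fold_ge0 ?ltr0n//.
by rewrite (le_trans (_ : 1 <= a%:R))// ?ler1n// lerDl cf_fold_ge0.
Qed.

Lemma four_geometric_lt (R : realType) (e : R) : 0 < e ->
  exists k, (4^-1 : R) ^+ k < e.
Proof.
move=> e0; have /cvgrPdist_lt/(_ _ e0) : ((4^-1 : R) ^+ n @[n --> \oo] --> 0).
  by apply: cvg_expr; rewrite ger0_norm; lra.
case=> k _ /(_ k (leqnn k)).
rewrite sub0r normrN ger0_norm ?exprn_ge0 ?invr_ge0//.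
by exists k.
Qed.

(** Convergents that share 2k partial quotients are 4^(-k)-close, so they form
    a Cauchy sequence; prefixing one more period is a Lipschitz operation that
    shifts this sequence, so it fixes the limit. *)
Lemma periodic_cfrac_fix (R : realType) (s : seq nat) :
  s != [::] -> all (ltn 0) s ->
  0 <= periodic_cfrac R s /\
  foldr (@cf_step R) (periodic_cfrac R s) s = periodic_cfrac R s.
Proof.
move=> sn0 s0; rewrite /periodic_cfrac.
set d := fun i => nth 0%N s (i %% size s).
have szs : (0 < size s)%N by case: (s) sn0.
have d0 i : (0 < d i)%N by apply: (all_nthP 0%N s0); rewrite ltn_mod.
have all_d (f : nat -> nat) n :
    (forall i, (0 < f i)%N) -> all (ltn 0) (mkseq f n).
  by move=> f0; apply/allP => _ /mapP[i _ ->]; exact: f0.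
set u := fun n => cfrac R (mkseq d n).
have u01 n : 0 <= u n <= 1 by apply/cfrac_itv/all_d.
have u_split m n : u (m + n)%N =
    foldr (@cf_step R) (cfrac R (mkseq (fun i => d (m + i)%N) n)) (mkseq d m).
  by rewrite /u /mkseq iotaD map_cat /cfrac foldr_cat -/(@cf_step R) add0n
    -[X in iota X n]addn0 iotaDl -map_comp.
have u_cvg : cvgn u.
  apply: cauchy_cvg; apply: cauchy_exP => e e0.
  have [k ke] := four_geometric_lt e0.
  exists (u k.*2); exists k.*2 => // n /= kn.
  rewrite /ball /= -(subnKC kn) -{1}(addn0 k.*2) !u_split.
  have I m := cfrac_itv R (all_d (fun i => d (k.*2 + i)%N) m (fun i => d0 _)).
  have /andP[a0 a1] := I 0%N; have /andP[b0 b1] := I (n - k.*2)%N.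
  apply: le_lt_trans ke.
  rewrite (le_trans (cf_fold_contract (size_mkseq _ _) _ _ _)) ?all_d//.
  apply: ler_piMr; first by rewrite exprn_ge0 ?invr_ge0.
  by rewrite ler_norml; lra.
set x := lim _.
have ux : u n @[n --> \oo] --> x by [].
have x0 : 0 <= x.
  by apply: limr_ge => //; apply: nearW => n; have /andP[] := u01 n.
split=> //.
have shift n : u (n + size s)%N = foldr (@cf_step R) (u n) s.
  rewrite addnC u_split; congr foldr.
    by rewrite /u; congr cfrac; apply: eq_mkseq => i; rewrite /d modnDl.
  rewrite /d -[RHS](mkseq_nth 0%N); apply/eq_in_map => i.
  by rewrite mem_iota => /andP[_ ilt]; rewrite modn_small.
apply: (@cvg_unique _ _ (u (n + size s)%N @[n --> \oo])) => //; last first.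
  by have := ux; rewrite -(cvg_shiftn (size s)).
apply/cvgrPdist_lt => e e0; move/cvgrPdist_lt: ux => /(_ _ e0).
apply: filterS => n; apply: le_lt_trans; rewrite shift.
by apply: cf_fold_dist => //; have /andP[] := u01 n.
Qed.

(** * Run lengths of binary words *)

Lemma RL_pos (w : seq bool) : all (ltn 0) (RL w).
Proof.
elim: w => //= b w; case: (RL w) => //= n t /andP[n0 t0].
by case: ifP => //= _; rewrite n0.
Qed.

Lemma RL_nil (w : seq bool) : (RL w == [::]) = (w == [::]).
Proof. by case: w => //= b w; case: (RL w) => // n t; case: ifP. Qed.

Lemma RL_negb (w : seq bool) : RL (map negb w) = RL w.
Proof.
elim: w => //= b w ->; case: (RL w) => // n t.
by case: w => [|c w] /=; rewrite ?eqxx//; case: b c => [] [].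
Qed.

Lemma RL_rcons (w : seq bool) (b : bool) :
  RL (rcons w b) =
  if w is c :: w' then
    if b == last c w' then
      if rev (RL w) is n :: t then rev (n.+1 :: t) else [:: 1%N]
    else rcons (RL w) 1%N
  else [:: 1%N].
Proof.
elim: w => // c [|d w] IH.
  by rewrite /= (eq_sym c); case: ifP.
have -> : rcons [:: c, d & w] b = c :: rcons (d :: w) b by [].
have RLc u : RL (c :: d :: u) =
   match RL (d :: u) with [::] => [:: 1%N]
   | n :: t => if c == d then n.+1 :: t else [:: 1%N, n & t] end by [].
rewrite rcons_cons RLc -rcons_cons IH RLc [last c _]/=.
have: RL (d :: w) != [::] by rewrite RL_nil.
case: (RL (d :: w)) => // n t _.
have [_|_] := eqVneq b (last d w); last by case: (c == d).
case: (lastP t) => [|t' x]; first by case: (c == d).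
rewrite -rcons_cons rev_rcons rev_cons revK /=.
by case: (c == d); rewrite -!rcons_cons rev_rcons rev_cons revK.
Qed.

Lemma RL_rev (w : seq bool) : RL (rev w) = rev (RL w).
Proof.
elim: w => // b w IH; rewrite rev_cons RL_rcons IH revK.
case: w IH => [|c w]//= IH.
have lst : rev (c :: w) = rcons (rev w) c by rewrite rev_cons.
move: IH; rewrite lst.
case E : (rcons (rev w) c) => [|d u]; first by case: (rev w) E.
have -> : last d u = c.
  by rewrite -[last d u]/(last d (d :: u)) -E last_rcons.
move=> _.
have: RL (c :: w) != [::] by rewrite RL_nil.
rewrite /=; case: (match RL w with [::] => _ | _ :: _ => _ end) => // n t _.
by case: (b == c); rewrite // -rev_cons.
Qed.

(** * The action of binary words on the half-line *)

(** Words act through the free monoid generated by the parabolic maps x + 1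
    and x / (x + 1), that is, by two elementary matrices of SL(2,Z). *)
Definition letter_map (R : realType) (b : bool) (x : R) : R :=
  if b then x + 1 else x / (x + 1).

Definition word_map (R : realType) (w : seq bool) (x : R) : R :=
  foldr (@letter_map R) x w.

Lemma word_map_cat (R : realType) (u v : seq bool) (x : R) :
  word_map (u ++ v) x = word_map u (word_map v x).
Proof. exact: foldr_cat. Qed.

Lemma letter_map_gt0 (R : realType) (b : bool) (x : R) :
  0 < x -> 0 < letter_map b x.
Proof. by case: b => x0 /=; rewrite ?divr_gt0//; lra. Qed.

Lemma letter_map_ge0 (R : realType) (b : bool) (x : R) :
  0 <= x -> 0 <= letter_map b x.
Proof. by case: b => x0 /=; rewrite ?divr_ge0//; lra. Qed.

Lemma word_map_gt0 (R : realType) (w : seq bool) (x : R) :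
  0 < x -> 0 < word_map w x.
Proof. by move=> x0; elim: w => //= b w; exact: letter_map_gt0. Qed.

Lemma word_map_ge0 (R : realType) (w : seq bool) (x : R) :
  0 <= x -> 0 <= word_map w x.
Proof. by move=> x0; elim: w => //= b w; exact: letter_map_ge0. Qed.

Lemma word_map_rcons1_gt0 (R : realType) (w : seq bool) (x : R) :
  0 <= x -> 0 < word_map (rcons w true) x.
Proof.
by move=> x0; rewrite -cats1 word_map_cat word_map_gt0//= ltr_wpDl.
Qed.

Lemma word_map_cons0_le1 (R : realType) (w : seq bool) (x : R) :
  0 <= x -> word_map (false :: w) x <= 1.
Proof.
move=> x0 /=; have := word_map_ge0 w x0; set y := word_map w x => y0.
by rewrite ler_pdivrMr; lra.
Qed.

(** The inversion x -> 1/x exchanges the two letter maps. *)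
Lemma word_map_inv (R : realType) (w : seq bool) (x : R) :
  0 < x -> (word_map w x)^-1 = word_map (map negb w) x^-1.
Proof.
move=> x0; elim: w => //= b w <-; have := word_map_gt0 w x0.
by move: (word_map w x) => y y0; case: b => /=; field; rewrite !gt_eqF//; lra.
Qed.

(** A run of b letters 1 adds b, and a run of a letters 0 adds a to the inverse;
    so a word ending with 1 acts as the continued fraction of its run lengths,
    up to an inversion when its first run consists of letters 1. *)
Lemma cf_fold_RL (R : realType) (w : seq bool) (x : R) : 0 <= x ->
  foldr (@cf_step R) x (RL (rcons w true)) =
  if head true w then (word_map (rcons w true) x)^-1
  else word_map (rcons w true) x.
Proof.
move=> x0; elim: w => [|b w] /=; first by rewrite /cf_step addrC.
have : RL (rcons w true) != [::] by rewrite RL_nil; case: (w).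
have := RL_pos (rcons w true); have := word_map_rcons1_gt0 w x0.
have -> : head b (rcons w true) = head true w by case: w.
case: (RL _) => // n t; move: (word_map _ x) => y y0 /= /andP[n0 _] _.
have := cf_fold_ge0 t x0.
have n1 : 1 <= n%:R :> R by rewrite ler1n.
case: (head true w); case: b => /=;
  move: (foldr _ x t) => F F0 yE.
- have -> : y = n%:R + F by rewrite -[y]invrK -yE invrK.
  by rewrite /cf_step -natr1; congr _^-1; lra.
- have -> : y = n%:R + F by rewrite -[y]invrK -yE invrK.
  by rewrite /cf_step; field; rewrite !gt_eqF//; lra.
- by rewrite -yE /cf_step addrC.
- rewrite -yE /cf_step -natr1; field; rewrite !gt_eqF//; lra.
Qed.

(** Farey words other than 0 and 1 have this form with p a palindrome, known as
    a central word. *)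
Definition bracket01 (p : seq bool) : seq bool := false :: rcons p true.

(** The interior word of the concatenation of 0q1 and 0p1. *)
Definition central_join (q p : seq bool) : seq bool := q ++ [:: true, false & p].

Lemma bracket01_cat (q p : seq bool) :
  bracket01 q ++ bracket01 p = bracket01 (central_join q p).
Proof. by rewrite /bracket01 /central_join /= cat_rcons rcons_cat. Qed.

Lemma alpha_plus_fix (R : realType) (p : seq bool) :
  let w := bracket01 p in
  0 <= alpha_plus R w /\ word_map w (alpha_plus R w) = alpha_plus R w.
Proof.
move=> w; rewrite /alpha_plus.
have [] := @periodic_cfrac_fix R (RL w) _ (RL_pos w); first by rewrite RL_nil.
by move=> a0 aE; split=> //; rewrite -[RHS]aE (@cf_fold_RL _ (false :: p)).
Qed.

(** Exchanging the digits of the reversal of 0p1 gives 0p'1, where p' is the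
    palindrome p with digits exchanged, so alpha_minus = 1 - y with y fixed by
    0p'1. Write y = z / (z + 1) with z the image of y under p'1; then
    1 - y = u / (u + 1) for u = 1/z, and inverting z = p'1(y) gives
    u = p0(1/y) = p01(u). *)
Lemma alpha_minus_fix (R : realType) (p : seq bool) : rev p = p ->
  exists u : R, [/\ 0 <= u,
    alpha_minus R (bracket01 p) = word_map [:: false] u &
    word_map (p ++ [:: false; true]) u = u].
Proof.
move=> pal; rewrite /alpha_minus.
have -> : rev (RL (false :: rcons p true)) =
          RL (false :: rcons (map negb p) true).
  by rewrite -RL_rev -RL_negb rev_cons rev_rcons pal /= map_rcons.
have [] := @alpha_plus_fix R (map negb p); rewrite /alpha_plus.
move: (periodic_cfrac _ _) => y y0 /=.
have := word_map_rcons1_gt0 (map negb p) y0.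
rewrite -/(word_map _ _); set z := word_map _ y => z0 yE.
have z1 : 0 < z + 1 by lra.
exists z^-1; split; first by rewrite invr_ge0 ltW.
  by rewrite -yE /=; field; rewrite !gt_eqF//; lra.
have y0' : 0 < y by rewrite -yE divr_gt0.
have zE : word_map (rcons p false) y^-1 = z^-1.
  by rewrite /z word_map_inv// map_rcons -map_comp (eq_map negbK) map_id.
rewrite -[RHS]zE -cats1 !word_map_cat /= -yE; congr word_map.
by field; rewrite !gt_eqF//; lra.
Qed.

(** * The two ends of a Farey gap *)

(** The relation Pq = qQ says that q is a prefix of PPP..., and a fixed point of
    P lies in the image of every prefix of PPP.... *)
Lemma fixpoint_prefix (R : realType) (P q Q : seq bool) (u : R) :
  P != [::] -> P ++ q = q ++ Q -> 0 <= u -> word_map P u = u ->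
  exists2 u', 0 <= u' & u = word_map q u'.
Proof.
move=> Pn0 + u0 uE; have [n] := ubnP (size q); elim: n q => // n IH q.
rewrite ltnS => qn PqQ; have [qP|Pq] := leqP (size q) (size P).
  have := congr1 (take (size q)) PqQ.
  rewrite (@take_size_cat _ _ q)// takel_cat// => qE.
  exists (word_map (drop (size q) P) u); first exact: word_map_ge0.
  by rewrite -word_map_cat -{1}qE cat_take_drop uE.
have := congr1 (take (size P)) PqQ.
rewrite (@take_size_cat _ _ P)// takel_cat ?(ltnW Pq)// => PE.
have qE : q = P ++ drop (size P) q by rewrite {1}PE cat_take_drop.
move: PqQ; rewrite {}qE -catA => /eqP; rewrite eqseq_cat// eqxx => /eqP PqQ.
have [|u' u'0 u'E] := IH _ _ PqQ.
  rewrite size_drop; apply: leq_trans qn.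
  by rewrite ltn_subrL (leq_ltn_trans _ Pq)// andbT; case: (P) Pn0.
by exists u' => //; rewrite word_map_cat -u'E.
Qed.

(** With r = q10p = p01q, the end alpha_plus of 0q1 is 0t with t fixed by q10, the
    end alpha_minus of 0p1 is 0u with u fixed by p01, and both fixed points lie
    in the image of r by the periodicity relations (q10)p = p(01q) and
    (p01)q = q(10p). *)
Lemma alpha_gap_ends (R : realType) (p q : seq bool) :
  rev p = p ->
  central_join q p = p ++ [:: false, true & q] ->
  let u := false :: central_join q p in
  exists t1 t2 : R, [/\ 0 <= t1, 0 <= t2,
    alpha_plus R (bracket01 q) = word_map u t1 &
    alpha_minus R (bracket01 p) = word_map u t2].
Proof.
move=> palp pq.
have [a0 aE] := alpha_plus_fix R q.
have [u [u0 alE uE]] := alpha_minus_fix R palp.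
set a := alpha_plus _ _ in a0 aE *; set t := word_map (rcons q true) a.
have t0 : 0 <= t by apply: word_map_ge0.
have atE : word_map [:: false] t = a by rewrite -[RHS]aE.
have tE : word_map (q ++ [:: true; false]) t = t.
  by rewrite [in RHS]/t -[in RHS]atE -cats1 !word_map_cat.
have [||||t1 t10 t1E] := @fixpoint_prefix R (q ++ [:: true; false]) p
    [:: false, true & q] t => //.
- by case: (q).
- by rewrite -catA.
have [||||t2 t20 t2E] := @fixpoint_prefix R (p ++ [:: false; true]) q
    [:: true, false & p] u => //.
- by case: (p).
- by rewrite -catA.
exists t1, t2; split=> //.
  rewrite -atE /=; congr (letter_map false _).
  by rewrite -{1}tE t1E -word_map_cat -catA.
rewrite alE /= pq; congr (letter_map false _).
by rewrite -{1}uE t2E -word_map_cat -catA.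
Qed.

Lemma letter_map_dist (R : realType) (b : bool) (x y : R) :
  0 <= x -> 0 <= y -> `|letter_map b x - letter_map b y| <= `|x - y|.
Proof.
move=> x0 y0; case: b => /=; first by rewrite opprD addrACA subrr addr0.
have -> : x / (x + 1) - y / (y + 1) = (x - y) / ((x + 1) * (y + 1)).
  by field; rewrite !gt_eqF//; lra.
rewrite normrM [in X in _ * X]ger0_norm ?invr_ge0; last nra.
by rewrite ler_pdivrMr ?ler_peMr//; nra.
Qed.

Lemma word_map_dist (R : realType) (w : seq bool) (x y : R) :
  0 <= x -> 0 <= y -> `|word_map w x - word_map w y| <= `|x - y|.
Proof.
move=> x0 y0; elim: w => //= b w; apply: le_trans.
by apply: letter_map_dist; apply: word_map_ge0.
Qed.

(** The word contains the factor 01, which acts as (x + 1) / (x + 2), of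
    derivative 1 / (x + 2)^2 at most 1/4. *)
Lemma word_map01_contract (R : realType) (p : seq bool) (x y : R) :
  0 <= x -> 0 <= y ->
  `|word_map (bracket01 p) x - word_map (bracket01 p) y|
    <= 4^-1 * `|x - y|.
Proof.
move=> x0 y0.
have L (s t : R) : 0 <= s -> 0 <= t ->
    `|word_map [:: false; true] s - word_map [:: false; true] t|
      <= 4^-1 * `|s - t|.
  move=> s0 t0 /=.
  have -> : (s + 1) / (s + 1 + 1) - (t + 1) / (t + 1 + 1) =
      (s - t) / ((s + 2) * (t + 2)).
    by field; rewrite !gt_eqF//; lra.
  rewrite normrM mulrC ler_wpM2r// ger0_norm ?invr_ge0; last nra.
  by rewrite lef_pV2 ?posrE; nra.
elim: p => [|[] p IH]; first exact: L.
  have -> : bracket01 (true :: p) = [:: false; true] ++ rcons p true by [].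
  rewrite !word_map_cat (le_trans (L _ _ _ _)) ?word_map_ge0//.
  by rewrite ler_wpM2l// word_map_dist.
apply: le_trans IH; rewrite /bracket01 rcons_cons -[false :: _]cat1s.
rewrite !word_map_cat.
by apply: letter_map_dist; apply: word_map_ge0.
Qed.

(** * Neighbours in the Farey lists *)

Definition farey_neighbours (v w : seq bool) : Prop :=
  exists n s1 s2, farey_list n = s1 ++ v :: w :: s2.

Lemma insert_concat_cat (s1 s2 : seq (seq bool)) (v w : seq bool) :
  exists s1' s2',
    insert_concat (s1 ++ v :: w :: s2) = s1' ++ [:: v, v ++ w, w & s2'].
Proof.
have [s2' E2] : exists s2', insert_concat (w :: s2) = w :: s2'.
  by case: s2 => [|u s2]; eexists.
elim: s1 => [|u s1 [s1' [s2'' IH]]].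
  by exists [::], s2'; rewrite -E2.
case: s1 IH => [|u' s1] IH.
  by exists [:: u; u ++ v], s2'; rewrite -E2.
by exists [:: u, u ++ u' & s1'], s2''; rewrite /= -[in RHS]IH.
Qed.

Lemma farey_neighbours_root : farey_neighbours [:: false] [:: true].
Proof. by exists 0%N, [::], [::]. Qed.

Lemma farey_neighbours_concat (v w : seq bool) : farey_neighbours v w ->
  farey_neighbours v (v ++ w) /\ farey_neighbours (v ++ w) w.
Proof.
move=> [n [s1 [s2 E]]].
have [s1' [s2' E']] := insert_concat_cat s1 s2 v w.
have En : farey_list n.+1 = s1' ++ [:: v, v ++ w, w & s2'] by rewrite -E' -E.
split; exists n.+1; rewrite En.
- by exists s1', (w :: s2').
- by exists (rcons s1' v), s2'; rewrite cat_rcons.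
Qed.

Lemma FW_neighbours (v w : seq bool) : farey_neighbours v w -> FW v /\ FW w.
Proof.
by move=> [n [s1 [s2 E]]]; split; exists n; rewrite E mem_cat !inE eqxx !orbT.
Qed.

(** * Words of the form 0p1 *)

Lemma FWstar_bracket01 (p : seq bool) : FW (bracket01 p) -> FWstar (bracket01 p).
Proof. by move=> Fp; split=> // -[]; case: p Fp. Qed.

(** Here a counts the letters of 0p1 over a two-word alphabet. The
    second bound drops the final letter 1, since the ends of a gap lie in the
    image of 0r and not of 0r1; the last of the a contractions is then replaced
    by the inclusion of an image of a word starting with 0 in [0,1]. *)
Definition contracting (R : realType) (p : seq bool) (a : nat) : Prop :=
  forall x y : R, 0 <= x -> 0 <= y ->
    `|word_map (bracket01 p) x - word_map (bracket01 p) y|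
      <= 4^-1 ^+ a * `|x - y| /\
    `|word_map (false :: p) x - word_map (false :: p) y| <= 4 * 4^-1 ^+ a.

Lemma contracting1 (R : realType) (p : seq bool) : contracting R p 1.
Proof.
move=> x y x0 y0; split; first by rewrite expr1; exact: word_map01_contract.
have wle (t : R) : 0 <= t -> 0 <= word_map (false :: p) t <= 1.
  by move=> t0; rewrite word_map_ge0// word_map_cons0_le1.
have := wle x x0; have := wle y y0.
by move: (word_map _ x) (word_map _ y) => u v hu hv; rewrite ler_norml; lra.
Qed.

Lemma contracting_join (R : realType) (q p : seq bool) (a b : nat) :
  contracting R q a -> contracting R p b ->
  contracting R (central_join q p) (a + b).
Proof.
move=> cq cp x y x0 y0; have [p1 p2] := cp x y x0 y0.
have pos w t : 0 <= t -> 0 <= word_map w t :> R by exact: word_map_ge0.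
rewrite -bracket01_cat.
have -> : false :: central_join q p = bracket01 q ++ (false :: p).
  by rewrite /central_join /bracket01 /= cat_rcons.
rewrite !word_map_cat exprD; split.
  have [+ _] := cq _ _ (pos (bracket01 p) x x0) (pos (bracket01 p) y y0).
  by move=> /le_trans; apply; rewrite -mulrA ler_wpM2l// exprn_ge0// invr_ge0.
have [+ _] := cq _ _ (pos (false :: p) x x0) (pos (false :: p) y y0).
by move=> /le_trans; apply; rewrite mulrCA ler_wpM2l// exprn_ge0// invr_ge0.
Qed.

(** * Sets of zero Hausdorff measure *)

(** A pair (a, l) stands for the closed interval from a to a + l. Finite covers
    without a bound on the mesh suffice: l^s <= e forces l to be small with e. *)
Definition covered (R : realType) (s e : R) (A : set R) : Prop :=
  exists t : seq (R * R),
    [/\ forall I, I \in t -> 0 <= I.2,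
        forall x, A x -> exists2 I, I \in t & I.1 <= x <= I.1 + I.2 &
        \sum_(I <- t) I.2 `^ s <= e].

Definition hausdorff_null (R : realType) (s : R) (A : set R) : Prop :=
  forall e, 0 < e -> covered s e A.

Lemma covered_sub (R : realType) (s e : R) (A B : set R) :
  A `<=` B -> covered s e B -> covered s e A.
Proof. by move=> AB [t [t0 tB te]]; exists t; split=> // x /AB; exact: tB. Qed.

Lemma covered_union (R : realType) (s e f : R) (A B : set R) :
  covered s e A -> covered s f B -> covered s (e + f) (A `|` B).
Proof.
move=> [t [t0 tA te]] [u [u0 uB uf]]; exists (t ++ u); split.
- by move=> I; rewrite mem_cat => /orP[/t0|/u0].
- by move=> x [/tA|/uB] [I It Ix]; exists I; rewrite // mem_cat It ?orbT.
- by rewrite big_cat lerD.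
Qed.

Lemma covered_itv (R : realType) (s a l : R) : 0 <= l ->
  covered s (l `^ s) [set x | a <= x <= a + l].
Proof.
move=> l0; exists [:: (a, l)]; split.
- by move=> I; rewrite inE => /eqP ->.
- by move=> x ax; exists (a, l); rewrite ?inE.
- by rewrite big_seq1.
Qed.

Lemma diameter_itv_le (R : realType) (a l : R) : 0 <= l ->
  (diameter [set x | (a <= x <= a + l)%R] <= l%:E)%E.
Proof.
move=> l0; rewrite ge_max lee_fin l0 /=; apply: ge_ereal_sup.
by move=> _ [x /= xI [y /= yI <-]]; rewrite lee_fin ler_norml; lra.
Qed.

Lemma diameter_pow_ge0 (R : realType) (s : R) (U : set R) :
  (0 <= diameter_pow s U)%E.
Proof. by rewrite /diameter_pow; case: ifP => // _; rewrite poweR_ge0. Qed.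

Lemma diameter_pow_itv_le (R : realType) (s a l : R) : 0 <= s -> 0 <= l ->
  (diameter_pow s [set x | (a <= x <= a + l)%R] <= (l `^ s)%:E)%E.
Proof.
move=> s0 l0; rewrite /diameter_pow; case: ifP => _.
  by rewrite lee_fin powR_ge0.
rewrite -poweR_EFin; apply: gt0_ler_poweR => //.
- by rewrite in_itv /= le_max lexx leey.
- by rewrite in_itv /= lee_fin l0 leey.
- exact: diameter_itv_le.
Qed.

(** A finite list of intervals, extended by empty sets to the sequences of sets
    required in a cover. *)
Definition itv_nth (R : realType) (t : seq (R * R)) (k : nat) : set R :=
  if (k < size t)%N then
    [set x | (nth (0, 0) t k).1 <= x <= (nth (0, 0) t k).1 + (nth (0, 0) t k).2]
  else set0.

Lemma itv_nth_partial_sum (R : realType) (s : R) (t : seq (R * R)) (n : nat) :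
  0 <= s -> (forall I, I \in t -> 0 <= I.2) ->
  (\sum_(0 <= k < n) diameter_pow s (itv_nth t k)
     <= (\sum_(I <- t) I.2 `^ s)%R%:E)%E.
Proof.
move=> s0; elim: t n => [|I t IH] n t0.
  by rewrite big1 ?big_nil// => k _; rewrite /itv_nth /diameter_pow eqxx.
case: n => [|n].
  by rewrite big_geq// lee_fin; apply: sumr_ge0 => i _; exact: powR_ge0.
rewrite big_nat_recl// big_cons EFinD leeD//.
  by apply: diameter_pow_itv_le; rewrite // t0// mem_head.
by apply: IH => J Jt; apply: t0; rewrite inE Jt orbT.
Qed.

Lemma hausdorff_measure0 (R : realType) (s : R) (A : set R) :
  0 < s -> hausdorff_null s A -> hausdorff_measure s A = 0%E.
Proof.
move=> s0 A0.
have pre0 delta : 0 < delta -> hausdorff_premeasure s delta A = 0%E.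
  move=> d0; apply/eqP; rewrite eq_le; apply/andP; split; last first.
    apply: le_ereal_inf_tmp => _ [V _ <-].
    by apply: nneseries_ge0 => k _ _; exact: diameter_pow_ge0.
  apply/lee_addgt0Pr => e e0; rewrite add0e.
  (* The budget delta^s forces every interval to have length at most delta. *)
  have [|t [t0 tA te]] := A0 (Num.min e (delta `^ s)).
    by rewrite lt_min e0 powR_gt0.
  move: te; rewrite le_min => /andP[te td].
  have tdelta I : I \in t -> I.2 <= delta.
    move=> It; rewrite leNgt; apply/negP => dI.
    have : delta `^ s < I.2 `^ s.
      by apply: gt0_ltr_powR; rewrite // nnegrE ltW// (lt_trans d0).
    apply/negP; rewrite -leNgt; apply: le_trans td.
    rewrite (big_rem _ It)/= lerDl.
    by apply: sumr_ge0 => i _; exact: powR_ge0.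
  apply: le_trans (_ : (\sum_(0 <= k <oo) diameter_pow s (itv_nth t k) <= _)%E).
    apply: ereal_inf_lbound; exists (itv_nth t) => //; split=> [k|x Ax].
      rewrite /itv_nth; case: ifPn => [kt|_]; last first.
        rewrite ge_max lee_fin ltW//=; apply: ge_ereal_sup.
        by move=> _ [x []].
      have It := mem_nth (0, 0) kt; have Id := tdelta _ It.
      by apply: (le_trans (diameter_itv_le _ (t0 _ It))); rewrite lee_fin.
    have [I It Ix] := tA _ Ax; exists (index I t) => //=.
    by rewrite /itv_nth index_mem It nth_index.
  apply: lime_le.
    by apply: is_cvg_nneseries => k _ _; exact: diameter_pow_ge0.
  apply: nearW => n; apply: le_trans (_ : ((\sum_(I <- t) I.2 `^ s)%R%:E <= _)%E);
    last by rewrite lee_fin.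
  exact: itv_nth_partial_sum (ltW s0) t0.
rewrite /hausdorff_measure; apply/eqP; rewrite eq_le; apply/andP; split.
  by apply: ge_ereal_sup => _ [d d0 <-]; rewrite pre0.
by apply: ereal_sup_ubound; exists 1 => //=; rewrite pre0.
Qed.

Lemma hausdorff_null_union (R : realType) (s : R) (A B : set R) :
  hausdorff_null s A -> hausdorff_null s B -> hausdorff_null s (A `|` B).
Proof.
move=> A0 B0 e e0; rewrite [e]splitr.
by apply: covered_union; [apply: A0|apply: B0]; rewrite divr_gt0.
Qed.

(** The pieces G cannot be all removed at once with finite covers; instead,
    A 0 is exhausted by finitely many of them up to some A k that is cheap to
    cover, the extra cost being shared among these pieces. *)
Lemma hausdorff_null_exhaust (R : realType) (s : R) (A G : nat -> set R) :
  (forall k, A k `<=` A k.+1 `|` G k) ->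
  (forall k, hausdorff_null s (G k)) ->
  (forall e, 0 < e -> exists k, covered s e (A k)) ->
  hausdorff_null s (A 0%N).
Proof.
move=> AG G0 Asmall e e0.
(* A prescribed extra cost h is halved at each step down. *)
have step k : forall f, covered s f (A k) ->
    forall h, 0 < h -> covered s (f + h) (A 0%N).
  elim: k => [|k IH] f Af h h0.
    have [t [t0 tA tf]] := Af; exists t; split=> //; lra.
  have h20 : 0 < h / 2 by rewrite divr_gt0.
  rewrite [h]splitr addrA; apply: IH => //.
  exact: covered_sub (AG k) (covered_union Af (G0 k _ h20)).
have e20 : 0 < e / 2 by rewrite divr_gt0.
have [k Ak] := Asmall _ e20.
by rewrite [e]splitr; exact: step Ak _ e20.
Qed.

(** * Two decay estimates *)

(** The cubic bound exp(3x) >= x^3 is enough to beat the factor m^2. *)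
Lemma pow4_small (R : realType) (s e : R) : 0 < s -> 0 < e ->
  exists N, forall m, (N <= m)%N ->
    (4 * 4^-1 ^+ m) `^ s * m%:R ^+ 2 <= e.
Proof.
move=> s0 e0; have l0 : 0 < ln 2 :> R by rewrite ln_gt0// ltr1n.
set c : R := s * ln 2 / 3; have c0 : 0 < c by rewrite divr_gt0// mulr_gt0.
have [N Ne] : exists N : nat, (c ^+ 3 * e)^-1 <= N%:R.
  exists (Num.bound (c ^+ 3 * e)^-1).
  by rewrite ltW// archi_boundP// invr_ge0 mulr_ge0 ?exprn_ge0 ?ltW.
exists (maxn N 2) => m; rewrite geq_max => /andP[Nm m2].
have m0 : 0 < m%:R :> R by rewrite ltr0n; lia.
(* For m >= 2 the factor 4 is absorbed by half of the exponent. *)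
have half : (4 * 4^-1 ^+ m) `^ s <= (2^-1 ^+ m) `^ s :> R.
  apply: ge0_ler_powR; rewrite ?nnegrE ?(ltW s0)
    ?mulr_ge0 ?exprn_ge0 ?invr_ge0//.
  have -> : 4^-1 = 2^-1 * 2^-1 :> R by lra.
  rewrite exprMn mulrA ler_piMl ?exprn_ge0 ?invr_ge0//.
  have -> : m = (2 + (m - 2))%N by lia.
  rewrite exprD mulrA (_ : 4 * 2^-1 ^+ 2 = 1 :> R); last by field.
  by rewrite mul1r exprn_ile1//; lra.
apply: (le_trans (ler_wpM2r (exprn_ge0 _ (ltW m0)) half)).
have -> : (2^-1 ^+ m) `^ s = (expR (m%:R * c) ^+ 3)^-1 :> R.
  rewrite /powR gt_eqF ?exprn_gt0 ?invr_gt0// lnXn ?invr_gt0// lnV ?posrE//.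
  by rewrite -expRM_natl -expRN; congr expR; rewrite /c -mulr_natr; field.
rewrite ler_pdivrMl ?exprn_gt0 ?expR_gt0//.
apply: (@le_trans _ _ ((m%:R * c) ^+ 3 * e)).
  have : (c ^+ 3 * e)^-1 <= m%:R by rewrite (le_trans Ne)// ler_nat.
  rewrite -(ler_pM2l (_ : 0 < c ^+ 3 * e)) ?mulr_gt0 ?exprn_gt0//.
  rewrite divff ?gt_eqF ?mulr_gt0 ?exprn_gt0// => h.
  have -> : (m%:R * c) ^+ 3 * e = m%:R ^+ 2 * (c ^+ 3 * e * m%:R) by ring.
  by rewrite ler_peMr// exprn_ge0// ltW.
have mc0 : 0 < m%:R * c by rewrite mulr_gt0.
rewrite ler_wpM2r ?(ltW e0)// lerXn2r ?nnegrE ?expR_ge0 ?(ltW mc0)//.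
by have := expR_ge1Dx (m%:R * c); lra.
Qed.

Lemma powR_inv_small (R : realType) (s e : R) : 0 < s -> 0 < e ->
  exists k, (k.+1%:R^-1) `^ s <= e.
Proof.
move=> s0 e0; have d0 : 0 < e `^ s^-1 by rewrite powR_gt0.
exists (Num.bound (e `^ s^-1)^-1).
have eE : (e `^ s^-1) `^ s = e.
  by rewrite -powRrM mulVf ?lt0r_neq0// powRr1// ltW.
rewrite -[leRHS]eE.
apply: ge0_ler_powR; rewrite ?nnegrE ?powR_ge0 ?invr_ge0 ?(ltW s0)//.
rewrite -[leRHS]invrK lef_pV2 ?posrE ?invr_gt0//.
apply: (@le_trans _ _ (Num.bound (e `^ s^-1)^-1)%:R); last by rewrite ler_nat.
by rewrite ltW// archi_boundP// invr_ge0 ltW.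
Qed.

(** * Gaps between Farey words *)

(** The gap between J_(0q1) and J_(0p1), where a and b count letters
    over the pair of words from which the splitting started. *)
Record farey_gap (R : realType) (q p : seq bool) (a b : nat) : Prop := FareyGap {
  gap_neighbours : farey_neighbours (bracket01 q) (bracket01 p);
  gap_pall : rev q = q;
  gap_palr : rev p = p;
  gap_comm : central_join q p = p ++ [:: false, true & q];
  gap_left_gt0 : (0 < a)%N;
  gap_right_gt0 : (0 < b)%N;
  gap_contract_left : contracting R q a;
  gap_contract_right : contracting R p b }.

(** Writing r = q10p = p01q, the commutation relation is inherited:
    q10r = q10p01q = r01q and r10p = p01q10p = p01r. *)
Lemma farey_gap_split (R : realType) (q p : seq bool) (a b : nat) :
  farey_gap R q p a b ->
  farey_gap R q (central_join q p) a (a + b) /\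
  farey_gap R (central_join q p) p (a + b) b.
Proof.
case=> nb pq pp pqE a0 b0 cq cp.
have [nl nr] := farey_neighbours_concat nb.
have palr : rev (central_join q p) = central_join q p.
  by rewrite [in RHS]pqE /central_join rev_cat !rev_cons pq pp !cat_rcons.
have cr := contracting_join cq cp.
rewrite bracket01_cat in nl nr.
split; split=> //; rewrite ?addn_gt0 ?a0//.
  by rewrite -[LHS]/(q ++ _ :: _ :: central_join q p) [in LHS]pqE -catA.
by rewrite -[LHS]/(central_join q p ++ _) [in LHS]pqE -catA.
Qed.

Definition between (R : realType) (v w : seq bool) : set R :=
  E_KU R `&` [set x | alpha_plus R v <= x <= alpha_minus R w].
Arguments between : clear implicits.

Lemma E_KU_dichotomy (R : realType) (w : seq bool) (x : R) :
  FWstar w -> E_KU R x -> x <= alpha_minus R w \/ alpha_plus R w <= x.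
Proof.
move=> ww [_ nJ]; have [|ax] := leP x (alpha_minus R w); first by left.
right; rewrite leNgt; apply/negP => xa; apply: nJ.
by exists w => //; rewrite /J/= in_itv/= ax.
Qed.

Lemma farey_gap_width (R : realType) (q p : seq bool) (a b : nat) :
  farey_gap R q p a b ->
  alpha_minus R (bracket01 p) - alpha_plus R (bracket01 q)
    <= 4 * 4^-1 ^+ (a + b).
Proof.
case=> _ _ pp pqE _ _ cq cp.
have [t1 [t2 [t10 t20 -> ->]]] := alpha_gap_ends R pp pqE.
have [_] := contracting_join cq cp t20 t10.
by apply: le_trans; exact: ler_norm.
Qed.

(** The budget e / (ab) is exactly shared by the two halves of a gap:
    1 / (ab) = 1 / (a(a+b)) + 1 / ((a+b)b). Each split raises a + b by at least 1,
    so after n splits the gap is short enough to be covered by one interval. *)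
Lemma covered_farey_gap (R : realType) (s e : R) (N : nat) :
  (forall m, (N <= m)%N -> (4 * 4^-1 ^+ m) `^ s * m%:R ^+ 2 <= e) -> 0 < e ->
  forall n q p a b, farey_gap R q p a b -> (N <= a + b + n)%N ->
  covered s (e / (a%:R * b%:R)) (between R (bracket01 q) (bracket01 p)).
Proof.
move=> NE e0; elim=> [|n IH] q p a b g Nab.
  have a1 : 1 <= a%:R :> R by rewrite ler1n (gap_left_gt0 g).
  have b1 : 1 <= b%:R :> R by rewrite ler1n (gap_right_gt0 g).
  rewrite addn0 in Nab; set l : R := 4 * 4^-1 ^+ (a + b).
  have l0 : 0 <= l by rewrite mulr_ge0// exprn_ge0// invr_ge0.
  have [t [t0 tA tl]] := covered_itv s (alpha_plus R (bracket01 q)) l0.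
  exists t; split=> //.
    move=> x [_ /andP[xl xr]]; apply: tA; rewrite /= xl /=.
    by have := farey_gap_width g; rewrite -/l; lra.
  apply: le_trans tl _; rewrite ler_pdivlMr; last by rewrite mulr_gt0; lra.
  apply: le_trans (NE _ Nab); rewrite ler_wpM2l ?powR_ge0// natrD; nra.
have a1 : 0 < a%:R :> R by rewrite ltr0n (gap_left_gt0 g).
have b1 : 0 < b%:R :> R by rewrite ltr0n (gap_right_gt0 g).
have [gl gr] := farey_gap_split g.
have -> : e / (a%:R * b%:R) =
    e / (a%:R * (a + b)%:R) + e / ((a + b)%:R * b%:R).
  by rewrite natrD; field; rewrite !gt_eqF// addr_gt0.
have a0 := gap_left_gt0 g; have b0 := gap_right_gt0 g.
have cl := IH _ _ _ _ gl; have cr := IH _ _ _ _ gr.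
apply: covered_sub (covered_union (cl _) (cr _)); [|lia|lia].
move=> x [xE /andP[xl xr]].
have [_ /FWstar_bracket01 w] := FW_neighbours (gap_neighbours gl).
have [h|h] := E_KU_dichotomy w xE.
  by left; split=> //=; rewrite xl.
by right; split=> //=; rewrite h.
Qed.

Lemma hausdorff_null_farey_gap (R : realType) (s : R) (q p : seq bool) :
  0 < s -> farey_gap R q p 1 1 ->
  hausdorff_null s (between R (bracket01 q) (bracket01 p)).
Proof.
move=> s0 g e e0; have [N NE] := pow4_small s0 e0.
have := covered_farey_gap NE e0 g (_ : (N <= 1 + 1 + N)%N).
by rewrite mulr1 divr1; apply; rewrite leq_addl.
Qed.

(** * The cusps 0 and 1 *)

Lemma rcons_nseq (T : Type) (b : T) (k : nat) : rcons (nseq k b) b = nseq k.+1 b.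
Proof. by elim: k => //= k ->. Qed.

Lemma left_neighbours (k : nat) :
  farey_neighbours [:: false] (bracket01 (nseq k false)).
Proof.
elim: k => [|k IH].
  by have [] := farey_neighbours_concat farey_neighbours_root.
by have [] := farey_neighbours_concat IH.
Qed.

Lemma right_neighbours (k : nat) :
  farey_neighbours (bracket01 (nseq k true)) [:: true].
Proof.
elim: k => [|k IH].
  by have [_] := farey_neighbours_concat farey_neighbours_root.
have [_] := farey_neighbours_concat IH.
by rewrite /bracket01 cats1 rcons_cons !rcons_nseq.
Qed.

Lemma farey_gap_left (R : realType) (k : nat) :
  farey_gap R (nseq k.+1 false) (nseq k false) 1 1.
Proof.
have [_ nb] := farey_neighbours_concat (left_neighbours k).
split; rewrite ?rev_nseq//; try exact: contracting1.
by rewrite /central_join -[in LHS]rcons_nseq cat_rcons.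
Qed.

Lemma farey_gap_right (R : realType) (k : nat) :
  farey_gap R (nseq k true) (nseq k.+1 true) 1 1.
Proof.
have [+ _] := farey_neighbours_concat (right_neighbours k).
rewrite cats1 /bracket01 rcons_cons => nb.
split; rewrite ?rev_nseq//; try exact: contracting1.
  by rewrite -rcons_nseq.
by rewrite /central_join -[in RHS]rcons_nseq cat_rcons.
Qed.

Lemma word_map_nseq_false (R : realType) (k : nat) (y : R) : 0 <= y ->
  word_map (nseq k false) y = y / (k%:R * y + 1).
Proof.
move=> y0; elim: k => [|k /= ->] /=; first by rewrite mul0r add0r divr1.
have ky : 0 <= k%:R * y by rewrite mulr_ge0.
by rewrite -natr1; field; rewrite !gt_eqF//; lra.
Qed.

Lemma word_map_nseq_true (R : realType) (k : nat) (y : R) :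
  word_map (nseq k true) y = y + k%:R.
Proof. by elim: k => [|k /= ->] /=; rewrite ?addr0// -natr1 addrA. Qed.

(** The fixed point u of 0^k01 lies in the image of 0^(k+1), which is
    bounded by 1 / (k+1), and alpha_minus = u / (u + 1) <= u. *)
Lemma alpha_minus_nseq_false_le (R : realType) (k : nat) :
  alpha_minus R (bracket01 (nseq k false)) <= k.+1%:R^-1.
Proof.
have [u [u0 -> uE]] := alpha_minus_fix R (rev_nseq k false).
have -> : word_map [:: false] u = u / (u + 1) by [].
have ule : u <= k.+1%:R^-1.
  rewrite -uE -cat_rcons rcons_nseq word_map_cat word_map_nseq_false /=; last lra.
  have k0 : 0 <= k.+1%:R * (u + 1) by rewrite mulr_ge0//; lra.
  rewrite ler_pdivrMr ?ltr_wpDl// mulrDr mulKf ?pnatr_eq0// mulr1.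
  by rewrite lerDl invr_ge0.
apply: le_trans ule; rewrite ler_pdivrMr; nra.
Qed.

Lemma alpha_plus_nseq_true_ge (R : realType) (k : nat) :
  1 - k.+1%:R^-1 <= alpha_plus R (bracket01 (nseq k true)).
Proof.
have [a0] := alpha_plus_fix R (nseq k true).
rewrite -/(bracket01 _); move: (alpha_plus _ _) a0 => a a0 <-.
rewrite /bracket01 rcons_nseq.
have -> : word_map (false :: nseq k.+1 true) a =
    letter_map false (word_map (nseq k.+1 true) a) by [].
rewrite word_map_nseq_true /=; have k0 : 1 <= k.+1%:R :> R by rewrite ler1n.
move: (k.+1%:R) k0 => K K1; rewrite ler_pdivlMr; last lra.
have -> : (1 - K^-1) * (a + K + 1) = a + K - (a + 1) / K.
  by field; rewrite gt_eqF//; lra.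
by rewrite gerBl divr_ge0; lra.
Qed.

(** Consecutive words 00^k1 are Farey neighbours, and their gaps accumulate only
    at 0. *)
Lemma hausdorff_null_left (R : realType) (s : R) : 0 < s ->
  hausdorff_null s
    (E_KU R `&` [set x | x <= alpha_minus R (bracket01 [::])]).
Proof.
move=> s0.
apply: (@hausdorff_null_exhaust R s
  (fun k => E_KU R `&` [set x | x <= alpha_minus R (bracket01 (nseq k false))])
  (fun k => between R (bracket01 (nseq k.+1 false)) (bracket01 (nseq k false)))).
- move=> k x [xE xk].
  have [_ /FWstar_bracket01 w] := FW_neighbours (left_neighbours k.+1).
  have [xk1|xk1] := E_KU_dichotomy w xE; first by left.
  by right; split=> //=; rewrite xk1.
- by move=> k; apply: hausdorff_null_farey_gap => //; exact: farey_gap_left.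
- move=> e e0; have [k ke] := powR_inv_small s0 e0; exists k.
  have k0 : 0 <= k.+1%:R^-1 :> R by rewrite invr_ge0.
  have [t [t0 tA te]] := covered_itv s 0 k0.
  exists t; split=> //; last exact: le_trans te ke.
  move=> x [[x01 _] xk]; apply: tA => /=; move: x01; rewrite /= in_itv /= add0r.
  by case/andP=> -> _; exact: le_trans xk (alpha_minus_nseq_false_le R k).
Qed.

(** Consecutive words 01^k1 are Farey neighbours, and their gaps accumulate only
    at 1. *)
Lemma hausdorff_null_right (R : realType) (s : R) : 0 < s ->
  hausdorff_null s
    (E_KU R `&` [set x | alpha_plus R (bracket01 [::]) <= x]).
Proof.
move=> s0.
apply: (@hausdorff_null_exhaust R s
  (fun k => E_KU R `&` [set x | alpha_plus R (bracket01 (nseq k true)) <= x])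
  (fun k => between R (bracket01 (nseq k true)) (bracket01 (nseq k.+1 true)))).
- move=> k x [xE xk].
  have [/FWstar_bracket01 w _] := FW_neighbours (right_neighbours k.+1).
  have [xk1|xk1] := E_KU_dichotomy w xE; last by left.
  by right; split=> //=; rewrite xk1 andbT.
- by move=> k; apply: hausdorff_null_farey_gap => //; exact: farey_gap_right.
- move=> e e0; have [k ke] := powR_inv_small s0 e0; exists k.
  have k0 : 0 <= k.+1%:R^-1 :> R by rewrite invr_ge0.
  have [t [t0 tA te]] := covered_itv s (1 - k.+1%:R^-1) k0.
  exists t; split=> //; last exact: le_trans te ke.
  move=> x [[x01 _] xk]; apply: tA => /=; move: x01; rewrite /= in_itv /= subrK.
  case/andP=> _ ->; rewrite andbT.
  exact: le_trans (alpha_plus_nseq_true_ge R k) xk.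
Qed.

Theorem proposition3p4 (R : realType) :
  hausdorff_dimension (E_KU R) = 0%E.
Proof.
have H s : 0 < s -> hausdorff_measure s (E_KU R) = 0%E.
  move=> s0; apply: hausdorff_measure0 => // e e0.
  have := hausdorff_null_union
    (hausdorff_null_left s0) (hausdorff_null_right s0) e0.
  apply: covered_sub => x xE.
  have [/FWstar_bracket01 w _] := FW_neighbours (right_neighbours 0).
  by have [h|h] := E_KU_dichotomy w xE; [left|right].
apply/eqP; rewrite eq_le; apply/andP; split.
  apply/lee_addgt0Pr => e e0; rewrite add0e.
  by apply: ereal_inf_lbound; exists e => //; split; [exact: ltW|exact: H].
by apply: le_ereal_inf_tmp => _ [s [s0 _] <-]; rewrite lee_fin.
Qed.
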